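(* Let $d\ge2$, let $\overline\rho,\overline\theta,\overline p_\rho,\overline p_\theta,\overline e_\theta,\overline k,\overline\alpha>0$ be constants and $\overline u\in\mathbb{R}^d$. The (linearized) Euler--Fourier--Korteweg system for $U=(\rho,u,\theta)^\top\in\mathbb{R}^{d+2}$, $u\in\mathbb{R}^d$, $x\in\mathbb{R}^d$, $$\rho_t+\overline u\cdot\nabla\rho+\overline\rho\,\nabla\cdot u=0,$$ $$\overline\rho\,u_t+\overline\rho\,(\overline u\cdot\nabla)u+\overline p_\rho\nabla\rho+\overline p_\theta\nabla\theta=\overline k\,\overline\rho\,\nabla\Delta\rho,$$ $$\overline\rho\,\overline e_\theta\theta_t+\overline\rho\,\overline e_\theta\,\overline u\cdot\nabla\theta+\overline\theta\,\overline p_\theta\nabla\cdot u=\overline\alpha\Delta\theta,$$ is not genuinely coupled.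
   Context: The system is the linearization around a constant state $(\overline\rho,\overline u,\overline\theta)$ of the inviscid, heat conducting compressible fluid with capillarity (Euler--Fourier--Korteweg); overlined quantities are values at that state of the derivatives of the pressure $p$ and internal energy $e$, of the capillarity $k$ and of the heat conductivity $\alpha$. After division by the constants multiplying the time derivatives the system has the form $U_t+\sum_{|\alpha|\le m}L^\alpha D^\alpha U=0$ with constant real $n\times n$ matrices. For $\xi\in\mathbb{R}^d\setminus\{0\}$, $\omega=\xi/|\xi|$, put $A(\xi)=\sum_{|\alpha|\text{ odd}}|\xi|^{|\alpha|-1}(-1)^{(|\alpha|-1)/2}\omega^\alpha L^\alpha$ and $B(\xi)=\sum_{|\alpha|\text{ even}}|\xi|^{|\alpha|}(-1)^{|\alpha|/2}\omega^\alpha L^\alpha$ (so $\widehat U_t+i|\xi|A\widehat U+B\widehat U=0$). Genuinely coupled: for every $\xi\ne0$, $(\mu I_n+A(\xi))\psi\ne0$ for every $\mu\in\mathbb{R}$ and every $\psi\in\ker B(\xi)$, $\psi\ne0$. *)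

(* Defs.v *)
From HB Require Import structures.
From mathcomp Require Import all_boot all_order all_algebra.
From mathcomp Require Import reals.
From mathcomp Require Import mpoly.
Set Implicit Arguments.
Unset Strict Implicit.
Unset Printing Implicit Defensive.
Import Order.TTheory GRing.Theory Num.Theory.
Local Open Scope ring_scope.

Section ConstantCoefficientSystem.
Variables (R : realType) (d n : nat).

Definition enorm (xi : 'rV[R]_d) : R := Num.sqrt (\sum_j xi 0 j ^+ 2).

Definition direction (xi : 'rV[R]_d) : 'rV[R]_d := (enorm xi)^-1 *: xi.

Definition monomial (w : 'rV[R]_d) (a : 'X_{1..d}) : R := \prod_j w 0 j ^+ a j.

(* The system is U_t + \sum_(|a| <= m) L a D^a U = 0; multi-indices are
   multinomials a : 'X_{1..d}, with |a| = mdeg a, and 'X_{1..d < m.+1} is the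
   finite type of those with |a| <= m. *)
Variables (m : nat) (L : 'X_{1..d} -> 'M[R]_n).

Definition symbolA (xi : 'rV[R]_d) : 'M[R]_n :=
  \sum_(a : 'X_{1..d < m.+1} | odd (mdeg a))
    (enorm xi ^+ (mdeg a).-1 * (-1) ^+ (mdeg a).-1./2
       * monomial (direction xi) a) *: L a.

Definition symbolB (xi : 'rV[R]_d) : 'M[R]_n :=
  \sum_(a : 'X_{1..d < m.+1} | ~~ odd (mdeg a))
    (enorm xi ^+ mdeg a * (-1) ^+ (mdeg a)./2
       * monomial (direction xi) a) *: L a.

Definition genuinely_coupled : Prop :=
  forall xi : 'rV[R]_d, xi != 0 ->
  forall (mu : R) (psi : 'cV[R]_n),
    symbolB xi *m psi = 0 -> psi != 0 ->
    (mu%:M + symbolA xi) *m psi != 0.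

End ConstantCoefficientSystem.

(* A linear constant-coefficient scalar differential operator on R^d is encoded
   as a polynomial in {mpoly R[d]}, the variable 'X_j standing for the partial
   derivative with respect to x_j and the product for composition; a matrix of
   such polynomials acts on column vectors of functions. *)
Section DifferentialOperators.
Variables (R : realType) (d : nat).

Definition grad : 'cV[{mpoly R[d]}]_d := \col_j 'X_j.

Definition diverg : 'rV[{mpoly R[d]}]_d := \row_j 'X_j.

Definition laplacian : {mpoly R[d]} := \sum_j 'X_j ^+ 2.

Definition advection (v : 'rV[R]_d) : {mpoly R[d]} := \sum_j v 0 j *: 'X_j.

(* For a system  tau_i (U_i)_t + \sum_j P i j (U_j) = 0,  the coefficient
   matrices L a obtained after dividing the i-th equation by tau_i. *)
Definition normalized_coeff n (tau : 'cV[R]_n) (P : 'M[{mpoly R[d]}]_n)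
    (a : 'X_{1..d}) : 'M[R]_n :=
  \matrix_(i, j) ((P i j)@_a / tau i 0).

End DifferentialOperators.

Section EulerFourierKorteweg.
Variables (R : realType) (d : nat).
Variables (rho theta p_rho p_theta e_theta k alpha : R) (u : 'rV[R]_d).

(* The unknowns (rho, u, theta) occupy the blocks 1, d, 1 of 1 + d + 1. *)
Definition efk_time : 'cV[R]_(1 + d + 1) :=
  col_mx (col_mx 1%:M (const_mx rho)) (rho * e_theta)%:M.

(* All terms are on the left-hand side, whence the signs of the capillarity
   term (the gradient of the Laplacian of the density) and of the heat
   conduction term. *)
Definition efk_space : 'M[{mpoly R[d]}]_(1 + d + 1) :=
  let C (c : R) : {mpoly R[d]} := c%:MP in
  let Dt := advection u in
  let row_rho := row_mx (row_mx Dt%:M (C rho *: diverg R d)) 0 in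
  let row_u :=
    row_mx (row_mx (C p_rho *: grad R d
                      - C (k * rho) *: (laplacian R d *: grad R d))
                   (C rho * Dt)%:M)
           (C p_theta *: grad R d) in
  let row_theta :=
    row_mx (row_mx 0 (C (theta * p_theta) *: diverg R d))
           (C (rho * e_theta) * Dt - C alpha * laplacian R d)%:M in
  col_mx (col_mx row_rho row_u) row_theta.

Definition efk_coeff : 'X_{1..d} -> 'M[R]_(1 + d + 1) :=
  normalized_coeff efk_time efk_space.

End EulerFourierKorteweg.

(* Main.v *)
(** Every plane wave whose velocity is transverse to the frequency [xi] and
    whose density and temperature vanish is annihilated by capillarity and heat
    conduction, and is merely advected by [u]: it lies in the kernel of
    [symbolB xi] and is an eigenvector of [symbolA xi] with the real eigenvalue
    [u . xi / |xi|]. Such waves exist as soon as [2 <= d]. *)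
Require Import Defs.
From mathcomp Require Import all_boot all_order all_algebra.
From mathcomp Require Import reals.
From mathcomp Require Import mpoly.
From mathcomp Require Import ring.
Import Order.TTheory GRing.Theory Num.Theory.
Local Open Scope ring_scope.

Lemma monomialU (R : realType) (d : nat) (w : 'rV[R]_d) (j : 'I_d) :
  monomial w U_(j) = w 0 j.
Proof.
rewrite /monomial (bigD1 j) //= big1 ?mulr1 ?mnm1E ?eqxx ?expr1 //.
by move=> i /negPf nij; rewrite mnm1E eq_sym nij expr0.
Qed.

Section FirstOrderAction.
Context {R : realType} {d n : nat} (m : nat) {L : 'X_{1..d} -> 'M[R]_n}.
Context {psi : 'cV[R]_n} {w : 'I_d -> 'cV[R]_n}.
Hypothesis L_psi : forall a, L a *m psi = \sum_j (U_(j)%MM == a)%:R *: w j.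

(** Under [L_psi] only multi-indices of degree 1 act on [psi], and [symbolB] collects even
    degrees. *)
Lemma symbolB_first_order (xi : 'rV[R]_d) : symbolB m L xi *m psi = 0.
Proof.
rewrite /symbolB mulmx_suml big1 // => a even_a.
rewrite -scalemxAl L_psi big1 ?scaler0 // => j _.
case: eqP => [Ua|]; last by rewrite scale0r.
by move: even_a; rewrite -Ua mdeg1.
Qed.

(** Only the terms [a = U_(j)] survive, and in degree 1 the power of [enorm xi] and the sign are
    both 1. The bound [0 < m] puts [U_(j)] in the range of summation. *)
Lemma symbolA_first_order (xi : 'rV[R]_d) : (0 < m)%N ->
  symbolA m L xi *m psi = \sum_j direction xi 0 j *: w j.
Proof.
move=> m_gt0; rewrite /symbolA mulmx_suml.
under eq_bigr do rewrite -scalemxAl L_psi scaler_sumr.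
rewrite exchange_big /=; apply: eq_bigr => j _.
have Uj_lt : (mdeg U_(j)%MM < m.+1)%N by rewrite mdeg1.
rewrite (bigD1 (BMultinom Uj_lt)) ?mdeg1 //= eqxx scale1r expr0.
rewrite big1 => [|a /andP[_ ne_a]].
  by rewrite addr0 expr0 !mul1r monomialU.
case: eqP => [Ua|]; last by rewrite scale0r scaler0.
by case/eqP: ne_a; apply: val_inj.
Qed.

End FirstOrderAction.

Definition velocity_mode {R : realType} {d : nat} (v : 'cV[R]_d) :
    'cV[R]_(1 + d + 1) :=
  col_mx (col_mx 0 v) 0.

Section VelocityModes.
Context {R : realType} {d : nat}.
Variables (rho theta p_rho p_theta e_theta k alpha : R) (u : 'rV[R]_d).
Hypothesis rho_neq0 : rho != 0.

(** The velocity columns of [efk_space] are homogeneous of order one: capillarity sits in the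
    density column and heat conduction in the temperature column. The [u 0 j] term is advection; the
    [v j 0] term is the divergence, felt by density and temperature. *)
Lemma efk_coeff_velocity_mode (v : 'cV[R]_d) (a : 'X_{1..d}) :
  efk_coeff rho theta p_rho p_theta e_theta k alpha u a *m velocity_mode v =
  \sum_j (U_(j)%MM == a)%:R *:
    (u 0 j *: velocity_mode v
     + v j 0 *: col_mx (col_mx rho%:M 0)
                       (theta * p_theta / (rho * e_theta))%:M).
Proof.
apply/matrixP => i z; rewrite {z}(ord1 z) summxE.
rewrite /velocity_mode mxE big_split_ord /= [X in _ + X]big1 ?addr0; last first.
  by move=> j _; rewrite col_mxEd !mxE mulr0.
rewrite big_split_ord /= big1 ?add0r; last first.
  by move=> j _; rewrite col_mxEu col_mxEu !mxE mulr0.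
under eq_bigr do rewrite col_mxEu col_mxEd.
have advE : (advection u)@_a = \sum_j u 0 j * (U_(j)%MM == a)%:R.
  by rewrite raddf_sum; apply: eq_bigr => j _; rewrite /= mcoeffZ mcoeffX.
rewrite /efk_coeff /normalized_coeff /efk_time /efk_space.
(* Rows are treated in the order temperature, density, velocity; in the first two, the sum over
   velocity components matches the sum over derivatives termwise. *)
case: (split_ordP i) => [i1 ->{i}|i1 ->{i}]; last first.
  apply: eq_bigr => j _.
  rewrite !(col_mxEd, row_mxEl, row_mxEr, mxE) (ord1 i1) mcoeffCM mcoeffX /=.
  by rewrite !mulr1n; ring.
case: (split_ordP i1) => [i2 ->{i1}|i2 ->{i1}].
  apply: eq_bigr => j _.
  rewrite !(col_mxEu, row_mxEl, row_mxEr, mxE) (ord1 i2) mcoeffCM mcoeffX /=.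
  by rewrite !mulr1n divr1; ring.
(* The velocity block is the scalar operator [rho * Dt], so only the diagonal entry contributes, and
   [rho] cancels. *)
rewrite (bigD1 i2) //= [X in _ + X]big1 ?addr0.
  rewrite !(col_mxEu, col_mxEd, row_mxEl, row_mxEr, mxE) eqxx mulr1n mcoeffCM.
  rewrite advE [X in X / rho]mulrC mulfK // mulr_suml; apply: eq_bigr => j _.
  by rewrite !(col_mxEu, col_mxEd, mxE); ring.
move=> j /negPf nij.
rewrite !(col_mxEu, col_mxEd, row_mxEl, row_mxEr, mxE) eq_sym nij.
by rewrite mulr0n mcoeff0 !mul0r.
Qed.

Lemma velocity_mode_eq0 (v : 'cV[R]_d) : (velocity_mode v == 0) = (v == 0).
Proof. by rewrite /velocity_mode !col_mx_eq0 !eqxx andbT. Qed.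

End VelocityModes.

(** The single column [xi^T] has rank at most 1, less than [d], so its left kernel is nonzero. *)
Lemma exists_transverse {R : realType} {d : nat} (xi : 'rV[R]_d) :
  (2 <= d)%N -> exists2 v : 'cV[R]_d, v != 0 & xi *m v = 0.
Proof.
move=> d_ge2.
have ker_neq0 : kermx xi^T != 0.
  rewrite -mxrank_eq0 mxrank_ker subn_eq0 -ltnNge.
  exact: leq_ltn_trans (rank_leq_col _) d_ge2.
have /rowV0Pn[w /sub_kermxP w_xi w_neq0] := ker_neq0.
exists w^T; first by rewrite trmx_eq0.
by rewrite -[LHS]trmxK trmx_mul trmxK w_xi trmx0.
Qed.

Theorem proposition6p1 (R : realType) (d : nat) (hd : (2 <= d)%N)
    (rho theta p_rho p_theta e_theta k alpha : R) (u : 'rV[R]_d)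
    (rho_gt0 : 0 < rho) (theta_gt0 : 0 < theta)
    (p_rho_gt0 : 0 < p_rho) (p_theta_gt0 : 0 < p_theta)
    (e_theta_gt0 : 0 < e_theta) (k_gt0 : 0 < k) (alpha_gt0 : 0 < alpha) :
  ~ genuinely_coupled 3
      (efk_coeff rho theta p_rho p_theta e_theta k alpha u).
Proof.
move=> coupled.
pose xi : 'rV[R]_d := const_mx 1.
have xi_neq0 : xi != 0.
  apply/rV0Pn; exists (Ordinal (ltnW hd)).
  by rewrite mxE oner_eq0.
have [v v_neq0 xi_v] := exists_transverse (direction xi) hd.
have L_psi := efk_coeff_velocity_mode rho theta p_rho p_theta e_theta k alpha
  u (lt0r_neq0 rho_gt0) v.
(* This [mu] is minus the advection speed along [direction xi], so it cancels the advection term of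
   [symbolA]. *)
have := coupled xi xi_neq0 (- \sum_j direction xi 0 j * u 0 j)
  (velocity_mode v) (symbolB_first_order 3 L_psi xi).
rewrite velocity_mode_eq0 => /(_ v_neq0) /eqP; apply.
rewrite mulmxDl mul_scalar_mx (symbolA_first_order 3 L_psi) //.
under [X in _ + X]eq_bigr do rewrite scalerDr !scalerA.
rewrite big_split /= -!scaler_suml scaleNr addrA addNr add0r.
(* What remains is the divergence vector times [direction xi *m v], which is zero by
   transversality. *)
move/matrixP/(_ 0 0): xi_v; rewrite !mxE => ->.
by rewrite scale0r.
Qed.
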